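(* Let $p>1$, let $\mathcal{G}=\sqcup_{i=1}^m\mathcal{T}_i$ be a forest (disjoint union of the trees $\mathcal{T}_1,\dots,\mathcal{T}_m$), and consider a generalized $p$-Laplacian operator $\mathcal{H}_p$ on $\mathcal{G}$ with variational eigenvalues $\lambda_1\le\dots\le\lambda_N$. If $f_k$ is an everywhere nonzero eigenfunction associated to the eigenvalue $\lambda_k=\dots=\lambda_{k+m-1}$ of $\mathcal{H}_p$, then $f_k$ changes sign on exactly $k-1$ edges. In other words, $f_k$ induces exactly $k-1+m$ nodal domains.
   Context: Let $\mathcal{G}=(V,E)$ be a finite undirected simple graph (not necessarily connected) with $N=|V|$ nodes, positive node weights $\varrho:V\to\mathbb{R}_+$ and positive symmetric edge weights $\omega:E\to\mathbb{R}_+$; $v\sim u$ means that $uv\in E$. For $p>1$ put $\phi_p(x)=|x|^{p-2}x$ (with $\phi_p(0)=0$). Given real coefficients $\kappa_u$, $u\in V$, the generalized $p$-Laplacian is $(\mathcal{H}_p f)(u)=\sum_{v\sim u}\omega_{uv}\phi_p(f(u)-f(v))+\kappa_u\phi_p(f(u))$ for $f:V\to\mathbb{R}$. A nonzero $f$ is an eigenfunction with eigenvalue $\lambda\in\mathbb{R}$ if $(\mathcal{H}_pf)(u)=\lambda\varrho_u\phi_p(f(u))$ for all $u\in V$. Krasnoselskii genus: for a closed symmetric set $A=-A$ in $\mathbb{R}^N$, $\gamma(A)$ is the least $k\in\mathbb{N}$ such that there is a continuous odd map $\varphi:A\to\mathbb{R}^k$ with $0\notin\varphi(A)$; $\gamma(A)=\infty$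 if no such $k$ exists and $\gamma(\emptyset)=0$. Let $\mathcal{S}_p=\{f:V\to\mathbb{R}:\|f\|_p=1\}$, $\mathcal{F}_k(\mathcal{S}_p)=\{A\subseteq\mathcal{S}_p: A=-A \text{ closed},\ \gamma(A)\ge k\}$, and $$\mathcal{R}_{\mathcal{H}_p}(f)=\frac{\sum_{uv\in E}\omega_{uv}|f(u)-f(v)|^p+\sum_{u\in V}\kappa_u|f(u)|^p}{\sum_{u\in V}\varrho_u|f(u)|^p}.$$ The variational eigenvalues are $\lambda_k=\min_{A\in\mathcal{F}_k(\mathcal{S}_p)}\max_{f\in A}\mathcal{R}_{\mathcal{H}_p}(f)$, $k=1,\dots,N$, so $\lambda_1\le\dots\le\lambda_N$. A function $f$ changes sign on the edge $uv\in E$ if $f(u)f(v)<0$. A nodal domain induced by $f$ is (the vertex set of) a maximal connected subgraph of $\mathcal{G}$ on which $f$ is nonzero and has constant sign. *)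

(* Defs.v *)
From HB Require Import structures.
From mathcomp Require Import all_boot all_order all_algebra.
From mathcomp Require Import all_classical all_reals all_analysis.

Set Implicit Arguments.
Unset Strict Implicit.
Unset Printing Implicit Defensive.

Import Order.TTheory GRing.Theory Num.Theory.
Import numFieldNormedType.Exports.

Local Open Scope classical_set_scope.
Local Open Scope ring_scope.

(* A graph on the finite type V is given by its adjacency relation e, assumed
   symmetric and irreflexive in the statement. *)
Section Graphs.
Variables (V : finType) (e : rel V).

Definition induced (A : {set V}) : rel V :=
  [rel x y | [&& x \in A, y \in A & e x y]].

Definition is_connected (A : {set V}) : bool :=
  (A != finset.set0)
    && [forall x in A, forall y in A, connect (induced A) x y].

(* Since e is symmetric, x :: y :: nil is an e-cycle as soon as e x y; genuine
   graph cycles are the simple e-cycles with at least three vertices. *)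
Definition is_acyclic (A : {set V}) : Prop :=
  forall c : seq V, ucycle (induced A) c -> (size c <= 2)%N.

Definition is_tree (A : {set V}) : Prop := is_connected A /\ is_acyclic A.

(* The graph is the disjoint union of the trees induced on T i, i < m. *)
Definition is_disjoint_union_of_trees (m : nat) (T : 'I_m -> {set V}) : Prop :=
  [/\ forall u, exists i, u \in T i,
      forall i j, i != j -> T i :&: T j = finset.set0,
      forall u v, e u v -> exists i, u \in T i /\ v \in T i
    & forall i, is_tree (T i)].

End Graphs.

Section PLaplacian.
Variables (R : realType) (V : finType) (e : rel V) (p : R).
Variables (rho : V -> R) (omega : V -> V -> R) (kappa : V -> R).

(* powR is total, with 0 `^ r = (r == 0)%:R, so that phi_p 0 = 0 also for
   p < 2. *)
Definition phi_p (x : R) : R := `|x| `^ (p - 2) * x.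

Definition p_laplacian (f : V -> R) (u : V) : R :=
  \sum_(v | e u v) omega u v * phi_p (f u - f v) + kappa u * phi_p (f u).

Definition is_eigenfunction (f : V -> R) (lambda : R) : Prop :=
  (exists u, f u != 0) /\
  forall u, p_laplacian f u = lambda * rho u * phi_p (f u).

(* The double sum runs over ordered pairs, hence counts each edge twice. *)
Definition rayleigh (f : V -> R) : R :=
  (2^-1 * (\sum_u \sum_(v | e u v) omega u v * `|f u - f v| `^ p)
     + \sum_u kappa u * `|f u| `^ p)
  / \sum_u rho u * `|f u| `^ p.

(* {ptws V -> R} is R^V with the product topology. *)
Definition is_symmetric (A : set {ptws V -> R}) : Prop :=
  forall f, A f -> A (fun u => - f u).

Definition has_odd_map (A : set {ptws V -> R}) (k : nat) : Prop :=
  exists g : {ptws V -> R} -> 'rV[R]_k,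
    [/\ {within A, continuous g},
        forall f, A f -> g (fun u => - f u) = - g f
      & forall f, A f -> g f != 0].

(* Least such k, and +oo if there is none; as 'rV_0 = {0}, the index k = 0 is
   admissible exactly when A is empty. *)
Definition krasnoselskii_genus (A : set {ptws V -> R}) : \bar R :=
  ereal_inf [set (k%:R)%:E | k in has_odd_map A].

Definition p_sphere : set {ptws V -> R} :=
  [set f | (\sum_u `|f u| `^ p) `^ p^-1 = 1].

Definition genus_family (k : nat) : set (set {ptws V -> R}) :=
  [set A | [/\ A `<=` p_sphere, is_symmetric A, closed A
             & ((k%:R)%:E <= krasnoselskii_genus A)%E]].

(* Indexed from k = 1.  For 1 <= k <= #|V| both extrema are attained: the
   members of the family are nonempty compact sets, and the family is closed
   for the Hausdorff distance. *)
Definition variational_eigenvalue (k : nat) : \bar R :=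
  ereal_inf [set ereal_sup [set (rayleigh f)%:E | f in A]
            | A in genus_family k].

End PLaplacian.

Section NodalCount.
Variables (R : realType) (V : finType) (e : rel V) (f : V -> R).

(* An undirected edge uv is the vertex set {u, v}, so it is counted once. *)
Definition sign_change_edges : {set {set V}} :=
  [set D | [exists u, exists v,
    [&& D == [set u; v], e u v & f u * f v < 0]]]%SET.

Definition has_constant_sign (A : {set V}) : bool :=
  [forall u in A, 0 < f u] || [forall u in A, f u < 0].

Definition nodal_domains : {set {set V}} :=
  [set A | maxset (fun B => is_connected e B && has_constant_sign B) A]%SET.

End NodalCount.

(* Main.v *)
Require Import Defs.
From HB Require Import structures.
From mathcomp Require Import all_boot all_order all_algebra.
From mathcomp Require Import all_classical all_reals all_analysis.
From mathcomp Require Import zify lra ring.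

(** Write s for the number of edges on which f changes sign, and t = g / f.
    Pairing the eigenvalue equation of f with f |t|^p turns the excess of the
    energy of g over lambda times its mass into a sum over the edges uv of
    omega_uv times the Picone defect of (f u, f v, t u, t v)
    ([energy_picone]).  By strict convexity of |x|^p the defect vanishes when
    t u = t v; otherwise it is positive if f has the same sign at u and v, and
    negative if f changes sign on uv ([picone_defect_gt0],
    [picone_defect_lt0]).

    Choose a root in every tree and require g to vanish at the roots.

    If moreover t is constant along each of the s sign-change edges, then g has
    Rayleigh quotient above lambda, uniformly on the sphere by compactness.
    These are s + m linear conditions, and every set of genus at least
    s + m + 1 contains a function that satisfies them, so that lambda_n exceeds
    lambda as soon as n > s + m ([variational_eigenvalue_gt]).

    If instead t is constant along the other edges, that is on every nodal
    domain, then g has Rayleigh quotient uniformly below lambda.  These g form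
    a linear space with one dimension for each nodal domain without a root.  A
    forest has as many edges as vertices minus components; comparing this count
    for the graph and for the graph of its same-sign edges gives s + m nodal
    domains ([card_nodal_domains]), so that the space has dimension at least s
    and lambda_k is below lambda for k <= s ([variational_eigenvalue_lt]).

    Hence lambda_k = lambda forces k > s and lambda_{k+m-1} = lambda forces
    k + m - 1 <= s + m, which together give k = s + 1.

    That the unit sphere of a space of dimension d >= k has genus at least k is
    the Borsuk-Ulam theorem, but here it follows from the finiteness of
    lambda_k, which provides some symmetric set of genus at least k inside R^N.
    An odd map R^d -> R^j with j < k <= d that vanishes only at 0 can be joined
    with identity maps and composed, which yields such a map R^N -> R^j
    ([odd_reduction_iter]) and bounds the genus of every symmetric set in R^N
    by j ([odd_reduction_genus]). *)

Set Implicit Arguments.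
Unset Strict Implicit.
Unset Printing Implicit Defensive.

Import Order.TTheory GRing.Theory Num.Theory.
Import numFieldNormedType.Exports.

(** * Components of acyclic graphs *)

Section Components.
Variable V : finType.
Implicit Types r : rel V.

Definition component r (x : V) : {set V} := [set y | connect r x y].
Definition components r : {set {set V}} := [set component r x | x : V].
Definition edge_set r : {set {set V}} :=
  [set D | [exists u, exists v, (D == [set u; v]) && r u v]].
Definition acyclic r : Prop := forall c : seq V, ucycle r c -> (size c <= 2)%N.

Lemma edge_setP r D :
  reflect (exists u v, D = [set u; v] /\ r u v) (D \in edge_set r).
Proof.
rewrite inE; apply: (iffP existsP) => [[u /existsP[v /andP[/eqP-> ruv]]]|].
  by exists u, v.
by move=> [u [v [-> ruv]]]; exists u; apply/existsP; exists v; rewrite eqxx.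
Qed.

Lemma set2_eq (a b x y : V) :
  [set x; y] = [set a; b] -> (x = a /\ y = b) \/ (x = b /\ y = a).
Proof.
move=> E.
have := set21 x y; have := set22 x y; rewrite E !inE.
have := set21 a b; have := set22 a b; rewrite -E !inE.
by do 4![case/orP=> /eqP ?]; subst; auto.
Qed.

Lemma component_refl r x : x \in component r x.
Proof. by rewrite inE connect0. Qed.

Lemma component_eq r x y : symmetric r ->
  (component r x == component r y) = connect r x y.
Proof.
move=> /sym_connect_sym sr.
apply/eqP/idP => [E|c].
  by have := component_refl r y; rewrite -E inE.
by apply/setP => z; rewrite !inE; apply: same_connect.
Qed.

(** A path joining the ends of a deleted edge would close up with that edge to
    a cycle. *)
Lemma acyclic_bridge r r0 a b : symmetric r -> irreflexive r -> acyclic r ->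
  subrel r0 r -> ~~ r0 a b -> r a b -> ~~ connect r0 a b.
Proof.
move=> sr ir ar s0 nab ab; apply/negP => /connectP[q pq eb].
case/shortenP: pq eb => q' pq' uq' _ eb.
have /ar : ucycle r (a :: q').
  rewrite /ucycle uq' andbT /= rcons_path (sub_path s0 pq') /=.
  by rewrite -eb sr.
case: q' pq' eb {uq'} => [|c [|//]] /=; first by move=> _ E; rewrite E ir in ab.
by move=> /andP[ac _] E; rewrite -E (negbTE nab) in ac.
Qed.

(** Deleting an edge of an acyclic graph increases the number of components by
    exactly one. *)
Lemma card_components_acyclic r : symmetric r -> irreflexive r -> acyclic r ->
  #|components r| + #|edge_set r| = #|V|.
Proof.
move En : #|edge_set r| => n; elim: n r En => [|n IH] r En sr ir ar.
  have nor x y : r x y = false.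
    apply/negP => rxy; have /cards0_eq E := En.
    suff: [set x; y] \in edge_set r by rewrite E inE.
    by apply/edge_setP; exists x, y.
  rewrite addn0 card_imset // => x y /eqP.
  rewrite component_eq // => /connectP[[|z s] /=]; first by move=> _ ->.
  by rewrite nor.
have /card_gt0P[D /[dup] DE /edge_setP[a [b [ED ab]]]] : 0 < #|edge_set r|.
  by rewrite En.
pose r0 := [rel x y | r x y && ([set x; y] != D)].
have sub0 : subrel r0 r by move=> x y /andP[].
have E0 : edge_set r0 = edge_set r :\ D.
  apply/setP => F; rewrite !inE; apply/idP/idP.
    move=> /existsP[u /existsP[v /andP[/eqP-> /andP[uv nD]]]]; rewrite nD /=.
    by apply/existsP; exists u; apply/existsP; exists v; rewrite eqxx.
  case/andP=> nD /existsP[u /existsP[v /andP[/eqP EF uv]]].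
  apply/existsP; exists u; apply/existsP; exists v.
  by rewrite EF eqxx /= uv -EF.
have sr0 : symmetric r0 by move=> x y /=; rewrite sr finset.setUC.
have nab : ~~ connect r0 a b.
  by apply: (acyclic_bridge sr ir ar sub0) => //=; rewrite ED eqxx andbF.
have IHr0 : #|components r0| + n = #|V|.
  apply: IH => //.
  - by move: En; rewrite E0 (cardsD1 D (edge_set r)) DE; lia.
  - by move=> x /=; rewrite ir.
  - move=> c /andP[cc uc]; apply: ar; rewrite /ucycle uc andbT.
    by case: c cc {uc} => //= x s; apply: sub_path.
set Ca := component r0 a; set Cb := component r0 b.
pose merge C := if (C == Ca) || (C == Cb) then Ca :|: Cb else C.
have cs := sym_connect_sym sr; have cs0 := sym_connect_sym sr0.
have nCab : Ca != Cb by rewrite component_eq.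
(* restoring the edge ab merges the components of a and b and no others *)
have mergeE x : component r x = merge (component r0 x).
  apply/eqP; rewrite finset.eqEsubset; apply/andP; split; apply/fintype.subsetP => y.
    suff cl : fingraph.closed r (merge (component r0 x)).
      rewrite inE => /(closed_connect cl) <-; rewrite /merge !component_eq //.
      by case: ifP; rewrite !inE // (cs0 x a) (cs0 x b).
    apply: (intro_closed cs) => u v ruv.
    case: (eqVneq [set u; v] D) => [E|uvD].
      have [us vs] : u \in Ca :|: Cb /\ v \in Ca :|: Cb.
        move: E; rewrite ED => /set2_eq.
        by case=> -[-> ->]; rewrite !inE !connect0 ?orbT.
      rewrite /merge; case: ifPn => // /norP[nxa nxb]; rewrite inE => xu.
      have cux : component r0 x = component r0 u by apply/eqP; rewrite component_eq.
      move: us nxa nxb; rewrite cux !component_eq // inE !inE (cs0 u a) (cs0 u b).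
      by case/orP=> ->.
    have cuv : connect r0 u v by apply: connect1; rewrite /= ruv.
    have trn z : connect r0 z u -> connect r0 z v by move=> h; apply: connect_trans cuv.
    rewrite /merge; case: ifP => _; rewrite !inE; last exact: trn.
    by case/orP=> /trn ->; rewrite ?orbT.
  have sub0c := connect_sub (fun x y h => connect1 (sub0 x y h)).
  have cab := connect1 ab.
  rewrite /merge !component_eq //; case: ifP => [|_]; rewrite !inE; last exact: sub0c.
  move=> xab yab.
  have xa : connect r x a.
    by case/orP: xab => /sub0c // h; apply: connect_trans h _; rewrite cs.
  apply: connect_trans xa _.
  by case/orP: yab => /sub0c // h; apply: connect_trans h.
have CaP : Ca \in components r0 by apply: imset_f.
have CbP : Cb \in components r0 by apply: imset_f.
have img : components r = merge @: (components r0 :\ Cb).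
  apply/setP => C; apply/imsetP/imsetP => [[x _ ->]|[C0]].
    case: (eqVneq (component r0 x) Cb) => [E|ne].
      exists Ca; first by rewrite !inE nCab.
      by rewrite mergeE E /merge !eqxx orbT.
    exists (component r0 x); last by rewrite mergeE.
    by rewrite !inE ne imset_f.
  by rewrite inE => /andP[_ /imsetP[x _ ->]] ->; exists x => //; rewrite mergeE.
have mem_eq C x : C \in components r0 -> x \in C -> C = component r0 x.
  case/imsetP=> z _ ->; rewrite inE => h; apply/eqP.
  by rewrite component_eq.
have inj : {in components r0 :\ Cb &, injective merge}.
  move=> C1 C2; rewrite !inE => /andP[n1 P1] /andP[n2 P2].
  rewrite /merge (negbTE n1) (negbTE n2) !orbF.
  have aux C : C \in components r0 -> C <> Ca :|: Cb.
    move=> CP E; have/(mem_eq _ _ CP) Ea : a \in C by rewrite E !inE connect0.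
    have/(mem_eq _ _ CP) Eb : b \in C by rewrite E !inE connect0 orbT.
    by move/eqP: nCab; apply; rewrite /Ca /Cb -Ea -Eb.
  case: ifP => [/eqP->|_]; case: ifP => [/eqP->|_] // E.
    by case: (aux C2).
  by case: (aux C1).
by rewrite img card_in_imset // -IHr0 (cardsD1 Cb (components r0)) CbP add1n -addSnnS.
Qed.

End Components.

Local Open Scope ring_scope.

(** * Trees and nodal domains *)

Section Forest.
Variables (V : finType) (e : rel V) (m : nat) (T : 'I_m -> {set V}).
Hypotheses (e_sym : symmetric e) (forest : is_disjoint_union_of_trees e T).

Lemma tree_edge i u v : e u v -> (u \in T i) = (v \in T i).
Proof.
have [_ dis out _] := forest => /out[j [uj vj]].
have [->|/dis E] := eqVneq i j; first by rewrite uj vj.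
have aux x : x \in T j -> (x \in T i) = false.
  by move=> xj; apply/negP => xi; move/setP: E => /(_ x); rewrite !inE xi xj.
by rewrite !aux.
Qed.

Lemma tree_connect i u v : u \in T i -> v \in T i -> connect e u v.
Proof.
have [_ _ _ /(_ i)[/andP[_ /forall_inP con] _]] := forest.
move=> /con/forall_inP h /h; apply: connect_sub => x y /and3P[_ _].
exact: connect1.
Qed.

Lemma tree_root i : exists r, r \in T i.
Proof. by have [_ _ _ /(_ i)[/andP[/set0Pn]]] := forest. Qed.

Lemma component_tree i u : u \in T i -> component e u = T i.
Proof.
move=> ui; apply/setP => v; rewrite inE; apply/idP/idP => [|/(tree_connect ui)//].
have cl : fingraph.closed e (mem (T i)) by move=> x y; apply: tree_edge.
by move/(closed_connect cl) => <-.
Qed.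

Lemma card_components_forest : #|components e| = m.
Proof.
rewrite -[RHS]card_ord -[RHS](card_imset (f := T)).
  apply: eq_card => C; apply/imsetP/imsetP => [[u _ ->]|[i _ ->]].
    have [/(_ u)[i ui] _ _ _] := forest.
    by exists i => //; rewrite (component_tree ui).
  by have [r ri] := tree_root i; exists r; rewrite ?(component_tree ri).
move=> i j Eij; apply/eqP/negP => /negP nij.
have [_ /(_ i j nij) dis _ _] := forest.
have [r ri] := tree_root i.
by move/setP: dis => /(_ r); rewrite !inE -Eij ri.
Qed.

(** No edge leaves a tree, so a cycle lies in the tree of its first vertex. *)
Lemma acyclic_forest : acyclic e.
Proof.
case=> // x s /andP[cs us].
have [/(_ x)[i xi] _ _ /(_ i)[_ acy]] := forest.
apply: acy; rewrite /ucycle us andbT /=.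
suff path_in q : forall z, z \in T i -> path e z q -> path (Defs.induced e (T i)) z q.
  exact: path_in.
elim: q => //= y q IH z zi /andP[zy yq].
have yi : y \in T i by rewrite -(tree_edge _ zy).
by rewrite IH // andbT; apply/and3P.
Qed.

End Forest.

Section NodalDomains.
Variables (R : realType) (V : finType) (e : rel V) (f : V -> R).
Hypotheses (e_sym : symmetric e) (e_irr : irreflexive e).
Hypothesis f_neq0 : forall u, f u != 0.

Definition same_sign_edge : rel V := [rel u v | e u v && (0 < f u * f v)].

Lemma same_sign_edge_sym : symmetric same_sign_edge.
Proof. by move=> u v; rewrite /same_sign_edge /= e_sym mulrC. Qed.

Lemma card_edge_set_sign :
  #|edge_set e| = (#|edge_set same_sign_edge| + #|sign_change_edges e f|)%N.
Proof.
have dis D : D \in edge_set same_sign_edge -> D \in sign_change_edges e f -> False.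
  case/edge_setP=> [u [v [-> /andP[_ uv]]]]; rewrite inE.
  case/existsP=> a /existsP[b /and3P[/eqP E _ ab]].
  suff E' : f u * f v = f a * f b.
    by move: uv ab; rewrite E' => /lt_trans h /h; rewrite ltxx.
  by case: (set2_eq E) => -[-> ->] //; rewrite mulrC.
rewrite -cardsUI.
have -> : edge_set same_sign_edge :&: sign_change_edges e f = finset.set0.
  by apply/setP => D; rewrite finset.in_setI finset.in_set0; apply/negP => /andP[/dis].
rewrite cards0 addn0; apply: eq_card => D; rewrite finset.in_setU.
apply/edge_setP/orP => [[u [v [-> uv]]]|[/edge_setP[u [v [-> /andP[uv _]]]]|]].
- have : f u * f v != 0 by rewrite mulf_neq0.
  case: (ltgtP (f u * f v) 0) => // s _; [right|left].
    by rewrite inE; apply/existsP; exists u; apply/existsP; exists v; rewrite eqxx uv.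
  by apply/edge_setP; exists u, v; split=> //; apply/andP.
- by exists u, v.
by rewrite inE => /existsP[u /existsP[v /and3P[/eqP-> uv _]]]; exists u, v.
Qed.

Lemma constant_sign_mul (B : {set V}) u v :
  has_constant_sign f B -> u \in B -> v \in B -> 0 < f u * f v.
Proof.
by case/orP=> /forall_inP h /h fu /h fv; [rewrite mulr_gt0|rewrite nmulr_rgt0].
Qed.

Lemma component_constant_sign x : has_constant_sign f (component same_sign_edge x).
Proof.
have cl : fingraph.closed same_sign_edge [pred y | 0 < f x * f y].
  apply: (intro_closed (sym_connect_sym same_sign_edge_sym)) => u v /andP[_ uv].
  rewrite !inE => xu; rewrite -(pmulr_rgt0 _ uv).
  rewrite [X in 0 < X](_ : _ = (f x * f u) * (f v * f v)).
    by rewrite pmulr_rgt0 // -expr2 exprn_even_gt0 //= f_neq0.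
  by ring.
have pos y : y \in component same_sign_edge x -> 0 < f x * f y.
  rewrite inE => /(closed_connect cl); rewrite !inE => <-.
  by rewrite -expr2 exprn_even_gt0 //= f_neq0.
case: (ltgtP (f x) 0) (f_neq0 x) => // fx _; apply/orP; [right|left].
  by apply/forall_inP => y /pos; rewrite nmulr_rgt0.
by apply/forall_inP => y /pos; rewrite pmulr_rgt0.
Qed.

Lemma component_connected x : is_connected e (component same_sign_edge x).
Proof.
apply/andP; split; first by apply/set0Pn; exists x; apply: component_refl.
have sC := sym_connect_sym same_sign_edge_sym.
set C := component _ x.
have aux y : y \in C -> connect (Defs.induced e C) x y.
  rewrite inE => /connectP[s]; elim/last_ind: s y => [|s z IH] y /=.
    by move=> _ ->; apply: connect0.
  rewrite rcons_path last_rcons => /andP[ps lz] ->.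
  apply: connect_trans (IH _ ps erefl) _; apply: connect1.
  have xl : connect same_sign_edge x (last x s) by apply/connectP; exists s.
  apply/and3P; split; rewrite ?inE //; last by case/andP: lz.
  exact: connect_trans xl (connect1 lz).
apply/forall_inP => y yC; apply/forall_inP => z zC.
apply: connect_trans (aux _ zC).
rewrite sym_connect_sym ?aux // => a b /=.
by rewrite /Defs.induced /= e_sym andbCA.
Qed.

Lemma connected_sub_component (B : {set V}) x :
  is_connected e B -> has_constant_sign f B -> x \in B ->
  B \subset component same_sign_edge x.
Proof.
move=> /andP[_ /forall_inP con] sB xB; apply/fintype.subsetP => y yB.
rewrite inE; move/forall_inP: (con x xB) => /(_ y yB).
apply: connect_sub => a b /and3P[aB bB eab]; apply: connect1.
by rewrite /same_sign_edge /= eab (constant_sign_mul sB).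
Qed.

Lemma nodal_domainsE : nodal_domains e f = components same_sign_edge.
Proof.
apply/setP => A; rewrite inE; apply/maxsetP/imsetP.
  case=> /andP[cA sA] maxA; have /andP[/set0Pn[x xA] _] := cA.
  exists x => //; apply/esym/maxA; last exact: connected_sub_component.
  by rewrite component_connected component_constant_sign.
case=> x _ ->; split; first by rewrite component_connected component_constant_sign.
move=> B /andP[cB sB] sub; apply/eqP; rewrite finset.eqEsubset sub andbT.
apply: connected_sub_component => //.
by apply: (fintype.subsetP sub); apply: component_refl.
Qed.

(** The graph and its subgraph of same-sign edges are both acyclic, so the number
    of components grows by the number of deleted edges. *)
Lemma card_nodal_domains (m : nat) (T : 'I_m -> {set V}) :
  is_disjoint_union_of_trees e T ->
  #|nodal_domains e f| = (#|sign_change_edges e f| + m)%N.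
Proof.
move=> forest; have ac := acyclic_forest forest.
have sub : subrel same_sign_edge e by move=> u v /andP[].
have := card_components_acyclic e_sym e_irr ac.
have <- : (#|components same_sign_edge| + #|edge_set same_sign_edge| = #|V|)%N.
  apply: (card_components_acyclic same_sign_edge_sym) => [x /=|c /andP[cc uc]].
    by rewrite /same_sign_edge /= e_irr.
  apply: ac; rewrite /ucycle uc andbT.
  by case: c cc {uc} => //= x s; apply: sub_path.
rewrite (card_components_forest forest) card_edge_set_sign nodal_domainsE.
by lia.
Qed.

End NodalDomains.

(** * Strict Picone inequalities *)

Section Picone.
Variables (R : realType) (p : R).
Hypothesis p_gt1 : 1 < p.
Implicit Types a b t r x y z : R.

Let p_gt0 : 0 < p. Proof. exact: lt_trans p_gt1. Qed.
Let p_neq0 : p != 0. Proof. by rewrite gt_eqF. Qed.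

Lemma normM_powR x y : `|x * y| `^ p = `|x| `^ p * `|y| `^ p.
Proof. by rewrite normrM powRM. Qed.

Lemma phi_pN x : phi_p p (- x) = - phi_p p x.
Proof. by rewrite /phi_p normrN mulrN. Qed.

Lemma phi_p_gt0 x : 0 < x -> phi_p p x = x `^ (p - 1).
Proof.
move=> x0; rewrite /phi_p gtr0_norm // mulrC.
have -> : p - 2 = (p - 1) - 1 by ring.
by rewrite mulr_powRB1 ?ltW // subr_gt0.
Qed.

Lemma mul_phi_p x : x * phi_p p x = `|x| `^ p.
Proof.
have [->|x0] := eqVneq x 0; first by rewrite mul0r normr0 powR0.
have pos z : 0 < z -> z * phi_p p z = `|z| `^ p.
  by move=> z0; rewrite phi_p_gt0 // mulr_powRB1 ?(ltW z0) // gtr0_norm.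
have [/ltW|x1|E] := ltgtP x 0; last by rewrite E eqxx in x0.
  rewrite le_eqVlt (negbTE x0) /= => x1.
  by rewrite -mulrNN -phi_pN pos ?oppr_gt0 // normrN.
exact: pos.
Qed.

(** Put w = 1 + p (t - 1).  If w is positive, then t is the arithmetic mean of 1
    and w with weights 1 - 1/p and 1/p, and the claim is that it exceeds their
    geometric mean w^(1/p).  Once that mean is factored out, this is the weighted
    sum of two instances of 1 + y <= exp y, one of them strict. *)
Lemma bernoulli_lt t : t != 1 -> 1 + p * (t - 1) < `|t| `^ p.
Proof.
move=> t1; set w := 1 + p * (t - 1).
have [w0|w0] := leP w 0.
  have [E|t0] := eqVneq t 0.
    rewrite E normr0 powR0 // /w E sub0r mulrN1 subr_lt0; exact: p_gt1.
  by apply: le_lt_trans w0 _; rewrite powR_gt0 // normr_gt0.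
have Et : t = (1 - p^-1) + p^-1 * w by rewrite /w; field.
have pV : 0 < p^-1 by rewrite invr_gt0.
have pV1 : p^-1 < 1 by rewrite invf_lt1.
have t0 : 0 < t.
  by rewrite Et addr_gt0 ?mulr_gt0 // subr_gt0.
have w1 : w != 1.
  by apply: contra_neq t1 => E; rewrite Et E; ring.
have lw0 : ln w != 0 by rewrite ln_eq0.
set L := p^-1 * ln w.
have wE : w = expR L * expR (ln w - L) by rewrite -expRD addrC subrK lnK.
have oneE : 1 = expR L * expR (- L) :> R by rewrite -expRD subrr expR0.
have eL := expR_gt0 L.
have h1 : 1 - L < expR (- L).
  by apply: expR_gt1Dx; rewrite oppr_eq0 mulf_neq0 // gt_eqF.
have h2 : 1 + (ln w - L) <= expR (ln w - L) by apply: expR_ge1Dx.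
have Lt : expR L < t.
  have -> : t = expR L * ((1 - p^-1) * expR (- L) + p^-1 * expR (ln w - L)).
    by rewrite mulrDr !(mulrCA (expR L)) -oneE -wE mulr1.
  rewrite -[ltLHS]mulr1 ltr_pM2l //.
  have E : (1 - p^-1) * (1 - L) + p^-1 * (1 + (ln w - L)) = 1 by rewrite /L; ring.
  rewrite -[ltLHS]E.
  apply: ltr_leD; first by rewrite ltr_pM2l // subr_gt0.
  by rewrite ler_pM2l.
rewrite gtr0_norm // [ltLHS](_ : w = (expR L) `^ p).
  by apply: gt0_ltr_powR; rewrite // nnegrE ltW.
by rewrite -expRM /L mulrAC mulVf // mul1r lnK.
Qed.

(** Strict convexity of |x|^p in homogeneous form: after division by the
    barycentre z of x and y, it is a weighted sum of Bernoulli inequalities at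
    x / z and y / z, at least one of which is strict. *)
Lemma jensen_lt a b x y : 0 < a -> 0 < b -> x != y ->
  `|a * x + b * y| `^ p < (a + b) `^ (p - 1) * (a * `|x| `^ p + b * `|y| `^ p).
Proof.
move=> a0 b0 xy; have s0 : 0 < a + b by rewrite addr_gt0.
have sp : (a + b) * (a + b) `^ (p - 1) = (a + b) `^ p by rewrite mulr_powRB1 ?ltW.
set z := (a * x + b * y) / (a + b).
have zE : a * x + b * y = (a + b) * z by rewrite /z [RHS]mulrC divfK // gt_eqF.
rewrite zE normM_powR (gtr0_norm s0) -sp mulrAC mulrC ltr_pM2l ?powR_gt0 //.
have [z0|z0] := eqVneq z 0.
  rewrite z0 normr0 powR0 // mulr0.
  have [x0|x0] := eqVneq x 0.
    rewrite x0 normr0 powR0 // mulr0 add0r mulr_gt0 // powR_gt0 // normr_gt0.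
    by rewrite -x0 eq_sym.
  apply: ltr_wpDr; first by rewrite mulr_ge0 ?powR_ge0 // ltW.
  by rewrite mulr_gt0 // powR_gt0 // normr_gt0.
have tE w : `|w| `^ p = `|z| `^ p * `|w / z| `^ p by rewrite -normM_powR mulrC divfK.
rewrite (tE x) (tE y) mulrCA [b * _]mulrCA -mulrDr mulrC.
rewrite ltr_pM2l ?powR_gt0 ?normr_gt0 //.
have tz1 : (a * (1 + p * (x / z - 1)) + b * (1 + p * (y / z - 1))) = a + b.
  have : a * (x / z) + b * (y / z) = a + b.
    by rewrite !mulrA -mulrDl zE mulfK.
  move=> E; rewrite -[RHS]addr0 -[in RHS](mulr0 p) -(subrr (a + b)) -{2}E; ring.
rewrite -tz1; have [x1|x1] := eqVneq (x / z) 1.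
  apply: ler_ltD; rewrite ?ler_pM2l ?ltr_pM2l //.
    by rewrite x1 subrr mulr0 addr0 normr1 powR1.
  apply: bernoulli_lt; apply: contra_neq xy => y1.
  by rewrite -[x](divfK z0) x1 -y1 divfK.
apply: ltr_leD; first by rewrite ltr_pM2l // bernoulli_lt.
rewrite ler_pM2l //; have [->|/bernoulli_lt/ltW//] := eqVneq (y / z) 1.
by rewrite subrr mulr0 addr0 normr1 powR1.
Qed.

(** With a and b the values of the eigenfunction at the ends of an edge, and a t
    and b r those of a competitor g, the subtracted term is
    phi_p (a - b) (|a t|^p / phi_p a - |b r|^p / phi_p b), in which the ratios
    have been simplified so that no division occurs. *)
Definition picone_defect a b t r : R :=
  `|a * t - b * r| `^ p - phi_p p (a - b) * (a * `|t| `^ p - b * `|r| `^ p).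

Lemma picone_defectNN a b t r : picone_defect (- a) (- b) t r = picone_defect a b t r.
Proof.
rewrite /picone_defect.
have -> : - a * t - - b * r = - (a * t - b * r) by ring.
have -> : - a - - b = - (a - b) by ring.
by rewrite normrN phi_pN; ring.
Qed.

Lemma picone_defectC a b t r : picone_defect b a r t = picone_defect a b t r.
Proof.
rewrite /picone_defect distrC.
have -> : b - a = - (a - b) by ring.
by rewrite phi_pN; ring.
Qed.

Lemma picone_defect_diag a b t : picone_defect a b t t = 0.
Proof.
by rewrite /picone_defect -!mulrBl normM_powR -mul_phi_p; ring.
Qed.

(** Up to a common change of sign, b < 0 < a, and this is Jensen's inequality
    with weights a and - b. *)
Lemma picone_defect_lt0 a b t r : a * b < 0 -> t != r -> picone_defect a b t r < 0.
Proof.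
wlog a0 : a b / 0 < a => [wl|] ab tr.
  have [a0|a0|E] := ltgtP a 0; last by rewrite E mul0r ltxx in ab.
    by rewrite -picone_defectNN wl ?mulrNN // oppr_gt0.
  exact: wl.
have b0 : 0 < - b by rewrite oppr_gt0 -(pmulr_rlt0 _ a0).
rewrite /picone_defect subr_lt0 phi_p_gt0 ?subr_gt0 ?(lt_trans _ a0) -?oppr_gt0 //.
by rewrite -!mulNr; apply: jensen_lt.
Qed.

(** By symmetry 0 < b <= a.  If b < a, the point t is the barycentre of r and (a t - b r) / (a - b)
    with weights b and a - b, and the claim is Jensen's inequality for it; if
    b = a, the defect is |a (t - r)|^p. *)
Lemma picone_defect_gt0 a b t r : 0 < a * b -> t != r -> 0 < picone_defect a b t r.
Proof.
wlog a0 : a b / 0 < a => [wl|] ab tr.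
  have [a0|a0|E] := ltgtP a 0; last by rewrite E mul0r ltxx in ab.
    by rewrite -picone_defectNN wl ?mulrNN // oppr_gt0.
  exact: wl.
have b0 : 0 < b by rewrite -(pmulr_rgt0 _ a0).
wlog : a b t r ab a0 b0 tr / b <= a => [wl|].
  by case/orP: (le_total b a) => /wl h; [|rewrite -picone_defectC]; apply: h;
    rewrite // 1?mulrC 1?eq_sym.
rewrite le_eqVlt => /orP[/eqP <-|ba].
  rewrite /picone_defect subrr /phi_p mulr0 mul0r subr0 -mulrBr normM_powR.
  by apply: mulr_gt0; rewrite powR_gt0 // normr_gt0 ?subr_eq0 // gt_eqF.
have c0 : 0 < a - b by rewrite subr_gt0.
set z := (a * t - b * r) / (a - b).
have zE : a * t - b * r = (a - b) * z by rewrite /z [RHS]mulrC divfK // gt_eqF.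
have rz : r != z.
  apply: contra_neq tr => E; apply: (mulfI (lt0r_neq0 a0)).
  by apply/eqP; rewrite -subr_eq0; move: zE; rewrite -E; lra.
have := jensen_lt b0 c0 rz.
have -> : b * r + (a - b) * z = a * t by rewrite -zE; ring.
have -> : b + (a - b) = a by ring.
rewrite normM_powR gtr0_norm // -(mulr_powRB1 (ltW a0) p_gt0) mulrAC mulrC.
rewrite ltr_pM2l ?powR_gt0 // => h.
rewrite /picone_defect zE normM_powR gtr0_norm // -(mulr_powRB1 (ltW c0) p_gt0).
rewrite phi_p_gt0 // [_ * (_ `^ (p - 1))]mulrC -mulrA -mulrBr mulr_gt0 ?powR_gt0 //.
by rewrite subr_gt0 ltrBlDl.
Qed.

End Picone.

Local Open Scope classical_set_scope.

(** * Continuity in spaces of functions *)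

Section Pointwise.
Variables (R : realType).

Lemma coordinate_continuous (I : eqType) (i : I) :
  continuous (fun x : {ptws I -> R} => x i).
Proof. exact: (@proj_continuous I (fun=> R) i). Qed.

Lemma ptws_cvgP (S : Type) (F : set_system S) (I : eqType)
    (h : S -> {ptws I -> R}) (l : {ptws I -> R}) : Filter F ->
  (forall i, h x i @[x --> F] --> l i) -> h x @[x --> F] --> l.
Proof.
move=> FF hi; apply/cvg_sup => i U [V] [[W] oW <-] Wl WU.
apply: (filterS WU); apply: (hi i) => /=.
exact: open_nbhs_nbhs.
Qed.

Lemma ptws_continuous (T : topologicalType) (I : eqType) (h : T -> {ptws I -> R}) :
  (forall i, continuous (fun x => h x i)) -> continuous h.
Proof. by move=> hc x; apply: (ptws_cvgP (F := nbhs x)) => i; apply: hc. Qed.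

Lemma rV_continuous (T : topologicalType) k (h : T -> 'rV[R]_k) :
  (forall j, continuous (fun x => h x ord0 j)) -> continuous h.
Proof.
move=> hc x U [P hP PU].
have aux : \forall y \near x, forall i j, P i j (h y i j).
  apply: filter_forall => i; apply: filter_forall => j.
  have := hP i j; rewrite (ord1 i) => Pj.
  exact: (hc j x _ Pj).
by apply: filterS aux => y /PU.
Qed.

(** At 0, |x|^p is squeezed between 0 and |x|. *)
Lemma continuous_norm_powR p : 1 < p -> continuous (fun x : R => `|x| `^ p).
Proof.
move=> p1 x; have p0 : 0 < p by apply: lt_trans p1.
have [->|x0] := eqVneq x 0.
  suff : `|y| `^ p @[y --> (0 : R)] --> (0 : R).
    by rewrite /continuous_at normr0 powR0 // gt_eqF.
  apply: (squeeze_cvgr (f := fun=> 0) (h := fun y => `|y|)).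
  - near=> y; rewrite powR_ge0 /=.
    have [->|y0] := eqVneq y 0; first by rewrite normr0 powR0 // gt_eqF.
    apply: ge1r_powR; last exact: ltW.
    rewrite normr_gt0 y0 /=; near: y.
    by exists 1 => //= z; rewrite /ball_ /= sub0r normrN => /ltW.
  - exact: cvg_cst.
  - by have := @norm_continuous _ R 0; rewrite /continuous_at normr0.
apply: (@continuous_comp _ _ _ (fun x : R => `|x|) (fun y => y `^ p)).
  exact: norm_continuous.
apply: differentiable_continuous; apply/derivable1_diffP.
by apply: derivable_powR; rewrite in_itv /= andbT normr_gt0.
Unshelve. all: by end_near. Qed.

Lemma cvg_sum_fun (S : Type) (F : set_system S) (I : Type) (r : seq I) (P : pred I)
    (h : I -> S -> R) (l : I -> R) : Filter F ->
  (forall i, P i -> h i x @[x --> F] --> l i) ->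
  \sum_(i <- r | P i) h i x @[x --> F] --> \sum_(i <- r | P i) l i.
Proof.
by move=> FF hl; apply: (cvg_big (op := +%R)) hl; apply: add_continuous.
Qed.

End Pointwise.

(** * The p-energy and the Rayleigh quotient *)

Section Energy.
Variables (R : realType) (V : finType) (e : rel V) (p : R).
Variables (rho : V -> R) (omega : V -> V -> R) (kappa : V -> R).
Variables (lambda : R) (f : V -> R).
Hypotheses (e_sym : symmetric e) (p_gt1 : 1 < p).
Hypothesis rho_gt0 : forall u, 0 < rho u.
Hypothesis omega_gt0 : forall u v, e u v -> 0 < omega u v.
Hypothesis omega_sym : forall u v, e u v -> omega u v = omega v u.
Hypothesis f_eigen : is_eigenfunction e p rho omega kappa f lambda.
Hypothesis f_neq0 : forall u, f u != 0.

Let p_gt0 : 0 < p. Proof. exact: lt_trans p_gt1. Qed.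

Definition p_energy (g : V -> R) : R :=
  2^-1 * (\sum_u \sum_(v | e u v) omega u v * `|g u - g v| `^ p)
  + \sum_u kappa u * `|g u| `^ p.

Definition p_mass (g : V -> R) : R := \sum_u rho u * `|g u| `^ p.

(** Multiplying the eigenvalue equation at u by f u |t u|^p and summing over u
    trades the potential and lambda for a sum over the edges. *)
Lemma energy_picone (t : V -> R) :
  p_energy (fun u => f u * t u) - lambda * p_mass (fun u => f u * t u) =
  2^-1 * \sum_u \sum_(v | e u v)
    omega u v * picone_defect p (f u) (f v) (t u) (t v).
Proof.
pose B u v := omega u v * (phi_p p (f u - f v) * (f u * `|t u| `^ p)).
(* the eigenvalue equation at u, multiplied by f u |t u|^p *)
have eqB u : \sum_(v | e u v) B u v
    = lambda * (rho u * `|f u * t u| `^ p) - kappa u * `|f u * t u| `^ p.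
  have [_ /(_ u)] := f_eigen; rewrite /p_laplacian.
  move=> /(congr1 ( *%R^~ (f u * `|t u| `^ p))).
  rewrite mulrDl mulr_suml => E.
  rewrite /B; under eq_bigr do rewrite mulrA.
  apply/eqP; rewrite eq_sym subr_eq eq_sym; apply/eqP.
  rewrite normM_powR // -(mul_phi_p p_gt1 (f u)).
  by transitivity (lambda * rho u * phi_p p (f u) * (f u * `|t u| `^ p));
    [rewrite -E; congr (_ + _)|]; ring.
have antiB u v : e u v ->
    omega u v * (phi_p p (f u - f v) * (f v * `|t v| `^ p)) = - B v u.
  by move=> uv; rewrite /B (omega_sym uv) -[f v - f u]opprB phi_pN; ring.
have swapB : \sum_u \sum_(v | e u v) B v u = \sum_u \sum_(v | e u v) B u v.
  rewrite (exchange_big_dep xpredT) //=; apply: eq_bigr => u _.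
  by apply: eq_bigl => v; rewrite e_sym.
have -> : \sum_u \sum_(v | e u v) omega u v * picone_defect p (f u) (f v) (t u) (t v)
    = \sum_u \sum_(v | e u v) omega u v * `|f u * t u - f v * t v| `^ p
      - 2 * \sum_u \sum_(v | e u v) B u v.
  rewrite mulr_natl mulr2n -{1}swapB -big_split /= -sumrB; apply: eq_bigr => u _.
  rewrite -big_split /= -sumrB; apply: eq_bigr => v uv.
  by rewrite -[B v u]opprK -antiB // /B /picone_defect; ring.
have -> : \sum_u \sum_(v | e u v) B u v = lambda * p_mass (fun u => f u * t u)
    - \sum_u kappa u * `|f u * t u| `^ p.
  by rewrite /p_mass mulr_sumr -sumrB; apply: eq_bigr => u _; apply: eqB.
by rewrite mulrBr mulrA mulVf ?pnatr_eq0 // mul1r /p_energy; ring.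
Qed.

Lemma p_mass_gt0 g : (exists u, g u != 0) -> 0 < p_mass g.
Proof.
move=> [u gu]; rewrite /p_mass (bigD1 u) //=; apply: ltr_pwDl.
  by rewrite mulr_gt0 // powR_gt0 // normr_gt0.
by apply: sumr_ge0 => v _; rewrite mulr_ge0 ?powR_ge0 // ltW.
Qed.

(** The edges along which t is required to be constant are those whose Picone
    defect has the sign opposite to that of c; the defect vanishes there. *)
Lemma energy_signed (c : R) (t : V -> R) : c != 0 ->
  (forall u v, e u v -> c * (f u * f v) < 0 -> t u = t v) ->
  (exists u v, e u v /\ t u != t v) ->
  0 < c * (p_energy (fun u => f u * t u) - lambda * p_mass (fun u => f u * t u)).
Proof.
move=> c0 flat [u [v [uv tuv]]]; rewrite energy_picone mulrCA mulr_gt0 ?invr_gt0 //.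
have gt0 a b : e a b -> t a != t b ->
    0 < c * (omega a b * picone_defect p (f a) (f b) (t a) (t b)).
  move=> ab tab; rewrite mulrCA pmulr_rgt0 ?omega_gt0 //.
  have fab : f a * f b != 0 by rewrite mulf_neq0.
  have : ~~ (c * (f a * f b) < 0) by apply: contra_neqN tab => /flat ->.
  rewrite -leNgt => cf.
  have [cn|cp|cE] := ltgtP c 0; last by rewrite cE eqxx in c0.
    rewrite nmulr_rgt0 //; apply: picone_defect_lt0 => //.
    by rewrite lt_neqAle fab -(nmulr_rge0 _ cn).
  rewrite pmulr_rgt0 //; apply: picone_defect_gt0 => //.
  by rewrite lt_neqAle eq_sym fab -(pmulr_rge0 _ cp).
have ge0 a b : e a b -> 0 <= c * (omega a b * picone_defect p (f a) (f b) (t a) (t b)).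
  move=> ab; have [->|/(gt0 _ _ ab)/ltW //] := eqVneq (t a) (t b).
  by rewrite picone_defect_diag // !mulr0.
rewrite mulr_sumr (bigD1 u) //=; apply: ltr_pwDl.
  rewrite mulr_sumr (bigD1 v) //=; apply: ltr_pwDl; first exact: gt0.
  by apply: sumr_ge0 => w /andP[/ge0].
by apply: sumr_ge0 => w _; rewrite mulr_sumr; apply: sumr_ge0 => z /ge0.
Qed.

Lemma p_sphereP (g : {ptws V -> R}) : p_sphere p g <-> \sum_u `|g u| `^ p = 1.
Proof.
rewrite /p_sphere /=; split=> [E|->]; last by rewrite powR1.
apply: (powR_injective (r := p^-1)); rewrite ?invr_gt0 // ?nnegrE ?ler01 //.
  by apply: sumr_ge0 => u _; apply: powR_ge0.
by rewrite E powR1.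
Qed.

Lemma p_sphere_neq0 (g : {ptws V -> R}) : p_sphere p g -> exists u, g u != 0.
Proof.
move=> /p_sphereP E; apply/existsP; apply: contraPT (oner_neq0 R).
rewrite negb_exists => /forallP g0; rewrite -E big1 ?eqxx // => u _.
by have /negPn/eqP -> := g0 u; rewrite normr0 powR0 // gt_eqF.
Qed.

Lemma norm_powR_sum_continuous :
  continuous (fun g : {ptws V -> R} => \sum_u `|g u| `^ p).
Proof.
move=> g.
apply: (cvg_sum_fun (F := nbhs g) (h := fun u (g : {ptws V -> R}) => `|g u| `^ p)
  (l := fun u => `|g u| `^ p)).
move=> u _.
apply: (@continuous_comp _ _ _ (fun g : {ptws V -> R} => g u) (fun x => `|x| `^ p)).
  exact: coordinate_continuous.
exact: continuous_norm_powR.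
Qed.

Lemma p_sphere_closed : closed (p_sphere p : set {ptws V -> R}).
Proof.
have -> : p_sphere p = (fun g : {ptws V -> R} => \sum_u `|g u| `^ p) @^-1` [set x | x = 1].
  by apply/seteqP; split=> g /p_sphereP.
apply: preimage_closed; [|exact: closed_eq].
by move=> g _; apply: norm_powR_sum_continuous.
Qed.

Lemma sub_p_sphere_compact (K : set {ptws V -> R}) :
  closed K -> K `<=` p_sphere p -> compact K.
Proof.
move=> cK KS.
have cB : compact [set g : {ptws V -> R} | forall u, (`[-1, 1]%classic : set R) (g u)].
  exact: (@tychonoff V (fun=> R) (fun=> `[-1, 1]%classic) (fun=> @segment_compact R _ _)).
apply: (subclosed_compact cK cB).
move=> g /KS /p_sphereP E u /=; rewrite in_itv /= -ler_norml.
rewrite leNgt; apply/negP => gu.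
suff : 1 < \sum_u `|g u| `^ p by rewrite E ltxx.
rewrite (bigD1 u) //=; apply: ltr_wpDr.
  by apply: sumr_ge0 => v _; apply: powR_ge0.
have -> : 1 = 1 `^ p :> R by rewrite powR1.
by rewrite gt0_ltr_powR // nnegrE.
Qed.

Lemma rayleigh_continuous (g : {ptws V -> R}) : (exists u, g u != 0) ->
  {for g, continuous (rayleigh e p rho omega kappa : {ptws V -> R} -> R)}.
Proof.
move=> g0.
have term u : (fun h : {ptws V -> R} => `|h u| `^ p) @ g --> `|g u| `^ p.
  apply: (@continuous_comp _ _ _ (fun g : {ptws V -> R} => g u) (fun x => `|x| `^ p)).
    exact: coordinate_continuous.
  exact: continuous_norm_powR.
have wsum (c : V -> R) : (fun h : {ptws V -> R} => \sum_u c u * `|h u| `^ p) @ g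
    --> \sum_u c u * `|g u| `^ p.
  apply: (cvg_sum_fun (F := nbhs g) (h := fun u (g : {ptws V -> R}) => c u * `|g u| `^ p)
    (l := fun u => c u * `|g u| `^ p)) => u _.
  by apply: cvgM; [exact: cvg_cst|exact: term].
have edges : (fun h : {ptws V -> R} =>
      \sum_u \sum_(v | e u v) omega u v * `|h u - h v| `^ p) @ g
    --> \sum_u \sum_(v | e u v) omega u v * `|g u - g v| `^ p.
  apply: (cvg_sum_fun (F := nbhs g)
    (h := fun u (g : {ptws V -> R}) => \sum_(v | e u v) omega u v * `|g u - g v| `^ p)
    (l := fun u => \sum_(v | e u v) omega u v * `|g u - g v| `^ p)) => u _.
  apply: (cvg_sum_fun (F := nbhs g)
    (h := fun v (g : {ptws V -> R}) => omega u v * `|g u - g v| `^ p)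
    (l := fun v => omega u v * `|g u - g v| `^ p)) => v _.
  apply: cvgM; first exact: cvg_cst.
  apply: (@continuous_comp _ _ _ (fun g : {ptws V -> R} => g u - g v) (fun x => `|x| `^ p)).
    exact: cvgB (@coordinate_continuous R V u g) (@coordinate_continuous R V v g).
  exact: continuous_norm_powR.
have energy : (p_energy : {ptws V -> R} -> R) @ g --> p_energy g.
  by apply: cvgD (wsum kappa); apply: cvgM edges; exact: cvg_cst.
have mass : (fun h : {ptws V -> R} => (p_mass h)^-1) @ g --> (p_mass g)^-1.
  exact: cvgV (lt0r_neq0 (p_mass_gt0 g0)) (wsum rho).
exact: cvgM energy mass.
Qed.

(** The Rayleigh quotient is continuous away from 0, so a strict bound at every
    point of a compact part of the sphere is uniform. *)
Lemma rayleigh_gap (c : R) (K : set {ptws V -> R}) :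
  compact K -> K `<=` p_sphere p ->
  (forall g, K g -> 0 < c * (p_energy g - lambda * p_mass g)) ->
  exists2 d, 0 < d &
    forall g, K g -> d <= c * (rayleigh e p rho omega kappa g - lambda).
Proof.
move=> cK KS pos.
have posR g : K g -> 0 < c * (rayleigh e p rho omega kappa g - lambda).
  move=> Kg; have m0 := p_mass_gt0 (p_sphere_neq0 (KS _ Kg)).
  rewrite [rayleigh _ _ _ _ _ _](_ : _ = p_energy g / p_mass g) //.
  rewrite -[lambda](mulfK (lt0r_neq0 m0)) -mulrBl mulrA.
  by rewrite divr_gt0 // pos.
have [K0|/set0P[g0 Kg0]] := eqVneq K set0; first by exists 1 => // g; rewrite K0.
have cont : {within K, continuous (fun g : {ptws V -> R} =>
    c * (rayleigh e p rho omega kappa g - lambda))}.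
  apply: continuous_in_subspaceT => g /set_mem/KS/p_sphere_neq0 /rayleigh_continuous rc.
  have diff : (fun h : {ptws V -> R} => rayleigh e p rho omega kappa h - lambda) @ g
      --> rayleigh e p rho omega kappa g - lambda.
    exact: cvgB rc (cvg_cst lambda).
  have scaled : (fun h : {ptws V -> R} =>
        c * (rayleigh e p rho omega kappa h - lambda)) @ g
      --> c * (rayleigh e p rho omega kappa g - lambda).
    exact: cvgM (cvg_cst c) diff.
  exact: scaled.
have [g1 /set_mem Kg1 min] := compact_EVT_min (ex_intro _ _ Kg0) cK cont.
exists (c * (rayleigh e p rho omega kappa g1 - lambda)); first exact: posR.
by move=> g /mem_set; apply: min.
Qed.

End Energy.

(** * Odd maps and the genus *)

Section OddReduction.
Variable R : realType.

(** A continuous odd map R^a -> R^b that vanishes only at 0.  All R^a are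
    represented by the one space of real sequences, and the condition on zeros
    looks only at the first a and b coordinates; the dimensions then occur in no
    type, and maps between different dimensions can be composed and joined
    without casts. *)
Definition odd_reduction (a b : nat) : Prop :=
  exists h : {ptws nat -> R} -> {ptws nat -> R},
    [/\ continuous h,
        forall x, h (fun i => - x i) = (fun i => - h x i)
      & forall x, (forall i, (i < b)%N -> h x i = 0) ->
          forall i, (i < a)%N -> x i = 0].

Lemma odd_reduction_le a b : (a <= b)%N -> odd_reduction a b.
Proof.
move=> ab; exists id; split=> // [x|x x0 i ia]; first exact: cvg_id.
exact: x0 (leq_trans ia ab).
Qed.

Lemma odd_reduction_trans b a c :
  odd_reduction a b -> odd_reduction b c -> odd_reduction a c.
Proof.
move=> [h [hc ho h0]] [k [kc ko k0]]; exists (k \o h); split.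
- by move=> x; apply: continuous_comp; [exact: hc|exact: kc].
- by move=> x /=; rewrite ho ko.
- by move=> x /k0/h0.
Qed.

(** The join with the identity map of R^c, placed after the first b coordinates. *)
Lemma odd_reduction_join a b c : odd_reduction a b -> odd_reduction (a + c) (b + c).
Proof.
move=> [h [hc ho h0]].
exists (fun x i => if (i < b)%N then h x i else x (i - b + a)%N); split.
- apply: ptws_continuous => i; case: (i < b)%N => x; last exact: coordinate_continuous.
  apply: (@continuous_comp _ _ _ h (fun y => y i)); first exact: hc.
  exact: coordinate_continuous.
- by move=> x; apply/funext => i; case: ifP => // _; rewrite ho.
move=> x x0 i iac; have [ia|ai] := ltnP i a.
  by apply: h0 ia => j jb; have := x0 j; rewrite jb; apply; lia.
have := x0 (i - a + b)%N; rewrite [X in if X then _ else _]ltnNge leq_addl /= addnK subnK //.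
by apply; lia.
Qed.

(** The join of R^a -> R^b with R^(n - a) maps R^n to a space of dimension
    b + (n - a) < n, from which induction leads down to R^b. *)
Lemma odd_reduction_iter a b n : (b < a)%N -> odd_reduction a b -> odd_reduction n b.
Proof.
move=> ba ab; elim/ltn_ind: n => n IH.
have [na|an] := leqP n a; first exact: odd_reduction_trans (odd_reduction_le na) ab.
have := odd_reduction_join (n - a) ab; rewrite subnKC ?(ltnW an) // => nb.
by apply: odd_reduction_trans nb (IH _ _); lia.
Qed.

End OddReduction.

Section Genus.
Variables (R : realType) (V : finType).
Implicit Types A K : set {ptws V -> R}.

Lemma genus_no_odd_map A k j : ((k%:R)%:E <= krasnoselskii_genus A)%E ->
  (j < k)%N -> ~ has_odd_map A j.
Proof.
move=> kA jk Aj; have := le_trans kA (ereal_inf_lbound (imageP _ Aj)).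
by rewrite lee_fin ler_nat leqNgt jk.
Qed.

(** Without a common zero on A, these functions would be the coordinates of a
    nonvanishing odd map from A to a space of dimension less than k. *)
Lemma genus_common_zero A k (I : finType) (c : I -> {ptws V -> R} -> R) :
  ((k%:R)%:E <= krasnoselskii_genus A)%E -> (#|I| < k)%N ->
  (forall i, continuous (c i)) ->
  (forall i g, c i (fun u => - g u) = - c i g) ->
  exists2 g, A g & forall i, c i g = 0.
Proof.
move=> kA Ik cc co; apply/not_exists2P => no0; apply: (genus_no_odd_map kA Ik).
exists (fun g => \row_j c (enum_val j) g); split.
- apply: continuous_subspaceT; apply: rV_continuous => j.
  rewrite (_ : (fun g => _) = c (enum_val j)); first exact: cc.
  by apply/funext => g; rewrite mxE.
- by move=> g _; apply/rowP => j; rewrite !mxE co.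
move=> g Ag; apply/negP => /eqP g0.
have [//|] := no0 g; apply => i.
by move/rowP: g0 => /(_ (enum_rank i)); rewrite !mxE enum_rankK.
Qed.

(** The restriction to A of an odd map R^N -> R^j that vanishes only at 0 shows that
    the genus of A is at most j. *)
Lemma odd_reduction_genus A k j p : 1 < p -> A `<=` p_sphere p ->
  ((k%:R)%:E <= krasnoselskii_genus A)%E -> (j < k)%N -> ~ odd_reduction R #|V| j.
Proof.
move=> p1 AS kA jk [h [hc ho h0]].
pose ext (g : {ptws V -> R}) : {ptws nat -> R} := fun i =>
  oapp (fun o : 'I_#|V| => g (enum_val o)) 0 (insub i).
have extc : continuous ext.
  apply: ptws_continuous => i; rewrite /ext; case: insubP => [l _ _|_] /= g.
    exact: coordinate_continuous.
  exact: cst_continuous.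
have [g Ag g0] : exists2 g, A g & forall i : 'I_j, h (ext g) i = 0.
  apply: (genus_common_zero kA) => [|i|i g]; first by rewrite card_ord.
    move=> g; apply: (@continuous_comp _ _ _ (h \o ext) (fun y => y (i : nat))).
      by apply: continuous_comp; [exact: extc|exact: hc].
    exact: coordinate_continuous.
  suff -> : ext (fun u => - g u) = (fun i => - ext g i) by rewrite ho.
  by apply/funext => l; rewrite /ext; case: insub => //=; rewrite oppr0.
have [u /negP[]] := p_sphere_neq0 p1 (AS _ Ag); apply/eqP.
have -> : g u = ext g (enum_rank u) by rewrite /ext valK /= enum_rankK.
by apply: h0 (ltn_ord _) => i ij; apply: g0 (Ordinal ij).
Qed.

(** Here w parametrizes by R^d a space of functions whose unit sphere lies in K.
    The odd map G on K is extended to that space by evaluating it at the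
    normalized function and multiplying by the p-th power of the norm; continuity
    at 0 holds because G is bounded on the compact set K. *)
Lemma odd_map_reduction K p d j (w : {ptws nat -> R} -> {ptws V -> R}) :
  1 < p -> closed K -> K `<=` p_sphere p ->
  continuous w -> (forall x, w (fun i => - x i) = (fun u => - w x u)) ->
  (forall x, (forall u, w x u = 0) -> forall i, (i < d)%N -> x i = 0) ->
  (forall x s, p_sphere p (fun u => s * w x u) -> K (fun u => s * w x u)) ->
  has_odd_map K j -> odd_reduction R d j.
Proof.
move=> p1 Kcl KS wc wo w0 wK [G [Gc Go G0]].
have p0 : 0 < p by apply: lt_trans p1.
have Kco := sub_p_sphere_compact p1 Kcl KS.
pose S (x : {ptws nat -> R}) := \sum_u `|w x u| `^ p.
have Sc : continuous S.
  move=> x; apply: (@continuous_comp _ _ _ w (fun g : {ptws V -> R} => \sum_u `|g u| `^ p)).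
    exact: wc.
  exact: norm_powR_sum_continuous.
have S_ge0 x : 0 <= S x by apply: sumr_ge0 => u _; apply: powR_ge0.
have S0 x : S x = 0 -> forall u, w x u = 0.
  move=> /eqP; rewrite psumr_eq0 => [/allP Sx u|u _]; last exact: powR_ge0.
  by have /eqP/powR_eq0_eq0/normr0_eq0 := Sx u (mem_index_enum u).
pose nw (x : {ptws nat -> R}) : {ptws V -> R} := fun u => (S x `^ p^-1)^-1 * w x u.
have nwK x : S x != 0 -> K (nw x).
  move=> Sx; have Sp : 0 < S x by rewrite lt_neqAle eq_sym Sx S_ge0.
  apply: wK; apply/(p_sphereP p1).
  under eq_bigr do rewrite normM_powR //.
  rewrite -mulr_sumr -/(S x) ger0_norm ?invr_ge0 ?powR_ge0 //.
  rewrite -powRN -powRrM mulNr mulVf ?gt_eqF // powRN powRr1 ?S_ge0 //.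
  by rewrite mulVf.
have So x : S (fun i => - x i) = S x.
  by rewrite /S wo; apply: eq_bigr => u _; rewrite normrN.
have nwo x : nw (fun i => - x i) = (fun u => - nw x u).
  by apply/funext => u; rewrite /nw So wo mulrN.
have nwc x : S x != 0 -> nw y @[y --> x] --> nw x.
  move=> Sx; have Sp : 0 < S x by rewrite lt_neqAle eq_sym Sx S_ge0.
  apply: (ptws_cvgP (F := nbhs x)) => u.
  have root : (S y `^ p^-1) @[y --> x] --> S x `^ p^-1.
    apply: (@continuous_comp _ _ _ S (fun y => y `^ p^-1)); first exact: Sc.
    apply: differentiable_continuous; apply/derivable1_diffP.
    by apply: derivable_powR; rewrite in_itv /= andbT.
  have wu : w y u @[y --> x] --> w x u.
    apply: (@continuous_comp _ _ _ w (fun g => g u)); first exact: wc.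
    exact: coordinate_continuous.
  by apply: cvgM wu; apply: cvgV root; rewrite gt_eqF // powR_gt0.
pose H (o : 'I_j) x := S x * G (nw x) ord0 o.
have Gco o : {within K, continuous (fun g => G g ord0 o)}.
  apply/subspace_continuousP => g Kg.
  apply: (@cvg_comp _ _ _ G (fun v : 'rV[R]_j => v ord0 o) _ (nbhs (G g))).
    by move/subspace_continuousP: Gc; apply.
  exact: coord_continuous.
have Hc o : continuous (H o).
  move=> x; have [Sx|Sx] := eqVneq (S x) 0; last first.
    have toK : nw y @[y --> x] --> within K (nbhs (nw x)).
      move=> U KU; have near0 : \forall y \near x, S y != 0.
        exact: (cvgr_neq0 _ (Sc x) Sx).
      have := nwc _ Sx _ KU; rewrite !near_simpl => nU.
      by near=> y; apply: (near nU) => //; apply: nwK; near: y.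
    have Gnw : G (nw y) ord0 o @[y --> x] --> G (nw x) ord0 o.
      apply: (@cvg_comp _ _ _ nw (fun g => G g ord0 o) _ _ _ toK).
      by move/subspace_continuousP: (Gco o); apply; apply: nwK.
    exact: cvgM (Sc x) Gnw.
  have [M M0 GM] := ex_strict_bound_gt0
    (compact_bounded (continuous_compact (Gco o) Kco)).
  have SM (b : R) : S y * b @[y --> x] --> (0 : R).
    have <- : S x * b = 0 by rewrite Sx mul0r.
    exact: cvgM (Sc x) (cvg_cst b).
  have Hx0 : H o x = 0 by rewrite /H Sx mul0r.
  suff lim : H o y @[y --> x] --> (0 : R).
    exact: (eq_rect_r (fun l : R => H o y @[y --> x] --> l) lim Hx0).
  apply: squeeze_cvgr (SM (- M)) (SM M).
  apply: nearW => y; rewrite /H; have [->|Sy] := eqVneq (S y) 0.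
    by rewrite !mul0r lexx.
  have := GM _ (imageP (fun g => G g ord0 o) (nwK _ Sy)) => /ltW.
  by rewrite ler_norml => /andP[h1 h2]; rewrite !ler_wpM2l.
exists (fun x i => oapp (fun o => H o x) 0 (insub i)); split.
- apply: ptws_continuous => i; case: insubP => [l _ _|_] /= x; first exact: Hc.
  exact: cst_continuous.
- move=> x; apply/funext => i; case: insubP => [l _ _|_] /=; last by rewrite oppr0.
  rewrite /H So nwo; have [->|Sx] := eqVneq (S x) 0; first by rewrite !mul0r oppr0.
  by rewrite Go ?mxE ?mulrN //; apply: nwK.
move=> x x0; apply/w0/S0/eqP/negPn/negP => Sx.
have /negP[] := G0 _ (nwK _ Sx); apply/eqP/rowP => o.
have := x0 o (ltn_ord o); rewrite valK /= /H mxE => /eqP.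
by rewrite mulf_eq0 (negbTE Sx) => /eqP.
Unshelve. all: by end_near.
Qed.

End Genus.

(** * The variational eigenvalues around lambda *)

Section Spectral.
Variables (R : realType) (V : finType) (e : rel V) (p : R).
Variables (rho : V -> R) (omega : V -> V -> R) (kappa : V -> R).
Variables (m : nat) (T : 'I_m -> {set V}) (lambda : R) (f : V -> R).
Hypotheses (e_sym : symmetric e) (e_irr : irreflexive e) (p_gt1 : 1 < p).
Hypothesis rho_gt0 : forall u, 0 < rho u.
Hypothesis omega_gt0 : forall u v, e u v -> 0 < omega u v.
Hypothesis omega_sym : forall u v, e u v -> omega u v = omega v u.
Hypothesis forest : is_disjoint_union_of_trees e T.
Hypothesis f_eigen : is_eigenfunction e p rho omega kappa f lambda.
Hypothesis f_neq0 : forall u, f u != 0.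
Variable root : 'I_m -> V.
Hypothesis rootP : forall i, root i \in T i.

(** For c = 1 the functions g for which g / f is constant along the sign-change
    edges, for c = -1 those for which it is constant along the other edges. *)
Definition flat_sphere (c : R) : set {ptws V -> R} :=
  [set g | [/\ p_sphere p g,
      forall u v, e u v -> c * (f u * f v) < 0 -> g u / f u = g v / f v
    & forall i, g (root i) = 0]].

Lemma flat_sphere_closed c : closed (flat_sphere c).
Proof.
have zero_closed (F : {ptws V -> R} -> R) : continuous F -> closed [set g | F g = 0].
  move=> Fc; apply: (preimage_closed (D := [set x : R | x = 0])) => [g _|].
    exact: Fc.
  exact: closed_eq.
pose D := [set uv : V * V | e uv.1 uv.2 /\ c * (f uv.1 * f uv.2) < 0].
have -> : flat_sphere c = p_sphere p `&`
    (\bigcap_(uv in D) [set g : {ptws V -> R} | g uv.1 / f uv.1 - g uv.2 / f uv.2 = 0]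
     `&` \bigcap_(i in setT) [set g : {ptws V -> R} | g (root i) = 0]).
  apply/seteqP; split=> [g [gS gf gr]|g [gS [gf gr]]].
    split=> //; split=> [uv [] /gf h /h E|i _]; last exact: gr.
    by rewrite /= E subrr.
  split=> // [u v uv s|i]; last exact: gr.
  by apply/eqP; rewrite -subr_eq0; apply/eqP; apply: (gf (u, v)).
apply: closedI; first exact: p_sphere_closed.
apply: closedI.
  apply: closed_bigI => uv _; apply: zero_closed => g.
  have cc (u : V) : (fun h : {ptws V -> R} => h u / f u) @ g --> g u / f u.
    exact: cvgM (@coordinate_continuous R V u g) (cvg_cst (f u)^-1).
  exact: cvgB (cc uv.1) (cc uv.2).
by apply: closed_bigI => i _; apply: zero_closed; apply: coordinate_continuous.
Qed.

(** If g / f were constant along every edge, then g would vanish with its values at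
    the roots; so some edge contributes strictly to the energy. *)
Lemma flat_sphere_gap c : c != 0 ->
  exists2 d, 0 < d & forall g, flat_sphere c g ->
    d <= c * (rayleigh e p rho omega kappa g - lambda).
Proof.
move=> c0; have KS : flat_sphere c `<=` p_sphere p by move=> g [].
have Kc := sub_p_sphere_compact p_gt1 (@flat_sphere_closed c) KS.
apply: (rayleigh_gap p_gt1 rho_gt0 Kc KS) => g [gS gf gr].
pose t u := g u / f u.
have gE : (fun u => f u * t u) = g by apply/funext => u; rewrite mulrC divfK.
rewrite -gE; apply: energy_signed => //.
apply/not_existsP => flat; have [u /negP[]] := p_sphere_neq0 p_gt1 gS.
have tE a b : connect e a b -> t a = t b.
  case/connectP=> s; elim: s a => [|z s IH] a /=; first by move=> _ ->.
  case/andP=> az zs bl; rewrite -(IH z zs bl).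
  by apply/eqP/negP => /negP taz; apply: (flat a); exists z.
have [/(_ u)[i ui] _ _ _] := forest.
rewrite -[g u](divfK (f_neq0 u)) -/(t u) (tE _ _ (tree_connect forest ui (rootP i))).
by rewrite /t gr mul0r mul0r.
Qed.

Let s := #|sign_change_edges e f|.

(** Constancy of g / f along the s sign-change edges and vanishing at the m roots
    are s + m odd conditions, so that a set of genus n > s + m contains a
    function satisfying all of them. *)
Lemma variational_eigenvalue_gt n : (s + m < n)%N ->
  (lambda%:E < variational_eigenvalue e p rho omega kappa n)%E.
Proof.
move=> sn; have [d d0 gap] := flat_sphere_gap (oner_neq0 R).
apply: (@lt_le_trans _ _ (lambda + d)%:E); first by rewrite lte_fin ltrDl.
apply: le_ereal_inf_tmp => _ [A [AS Asym Acl An] <-].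
have /choice[uv uvP] : forall D : {D | D \in sign_change_edges e f}, exists uv : V * V,
    sval D = [set uv.1; uv.2]%SET.
  case=> D DP; have := DP; rewrite inE => /existsP[u /existsP[v /and3P[/eqP E _ _]]].
  by exists (u, v).
pose t (g : {ptws V -> R}) u := g u / f u.
have tc u : continuous (t^~ u).
  by move=> g; exact: cvgM (@coordinate_continuous R V u g) (cvg_cst (f u)^-1).
pose c (i : {D | D \in sign_change_edges e f} + 'I_m) g :=
  match i with inl D => t g (uv D).1 - t g (uv D).2 | inr i => g (root i) end.
have [g Ag g0] : exists2 g, A g & forall i, c i g = 0.
  apply: (genus_common_zero An).
  - by rewrite card_sum card_sig card_ord.
  - case=> [D|i] g /=; last exact: coordinate_continuous.
    exact: cvgB (@tc (uv D).1 g) (@tc (uv D).2 g).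
  - by case=> [D|i] g //=; rewrite /t !mulNr -opprD.
have Kg : flat_sphere 1 g.
  split=> [|u v euv|i]; [exact: AS| |exact: (g0 (inr i))].
  rewrite mul1r => fuv.
  have DP : [set u; v]%SET \in sign_change_edges e f.
    by rewrite inE; apply/existsP; exists u; apply/existsP; exists v; rewrite eqxx euv.
  pose D0 : {D | D \in sign_change_edges e f} :=
    exist (fun D => is_true (D \in sign_change_edges e f)) _ DP.
  have := g0 (inl D0) => /eqP; rewrite /= subr_eq0 => /eqP.
  have := uvP D0; rewrite [sval D0]/= => /esym/set2_eq.
  by case=> -[-> ->].
apply: (@le_trans _ _ (rayleigh e p rho omega kappa g)%:E); last first.
  by apply: ereal_sup_ubound; exists g.
by rewrite lee_fin -lerBrDl; have := gap g Kg; rewrite mul1r.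
Qed.

(** The linear space spanned by flat_sphere (-1) has one dimension for each nodal
    domain without a root.  An odd map from its sphere to R^j with j < k would
    give one on all of R^N, and contradict the existence of a set of genus k. *)
Lemma flat_sphere_genus k : (k <= s)%N -> genus_family (V := V) p k !=set0 ->
  genus_family p k (flat_sphere (-1)).
Proof.
move=> ks [A [AS _ _ Ak]]; have KS : flat_sphere (-1) `<=` p_sphere p by move=> g [].
split=> //; last 1 first.
- apply: le_ereal_inf_tmp => _ [j Kj <-]; rewrite lee_fin ler_nat leqNgt.
  apply/negP => jk; apply: (odd_reduction_genus p_gt1 AS Ak jk).
  pose comp := component (same_sign_edge e f).
  pose rooted := [set comp (root i) | i : 'I_m]%SET.
  pose Q := enum (components (same_sign_edge e f) :\: rooted)%SET.
  pose idx u := index (comp u) Q.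
  (* there are s + m nodal domains, of which at most m contain a root *)
  have sQ : (s <= size Q)%N.
    rewrite -cardE cardsD.
    have := card_nodal_domains e_sym e_irr f_neq0 forest.
    rewrite nodal_domainsE // -/s => ->.
    have : (#|components (same_sign_edge e f) :&: rooted| <= #|rooted|)%N.
      by apply: subset_leq_card; apply: finset.subsetIr.
    have := leq_imset_card (fun i => comp (root i)) 'I_m.
    rewrite card_ord -/rooted; lia.
  apply: (@odd_reduction_iter R (size Q)); first exact: leq_trans jk (leq_trans ks sQ).
  (* x lists the values of g / f on the nodal domains in Q; on the domain of a
     root, the index is out of range and g vanishes *)
  pose w (x : {ptws nat -> R}) : {ptws V -> R} := fun u =>
    f u * (if (idx u < size Q)%N then x (idx u) else 0).
  apply: (odd_map_reduction p_gt1 (@flat_sphere_closed (-1)) KS (w := w)) Kj.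
  + apply: ptws_continuous => u x; rewrite /w; case: (idx u < size Q)%N.
      exact: cvgM (cvg_cst (f u)) (@coordinate_continuous R nat (idx u) x).
    exact: cst_continuous.
  + by move=> x; apply/funext => u; rewrite /w; case: ifP; rewrite ?mulrN // mulr0 oppr0.
  + move=> x wx i iQ; have := mem_nth finset.set0 iQ.
    rewrite mem_enum inE => /andP[_ /imsetP[u _ E]].
    have iE : idx u = i by rewrite /idx /comp -E index_uniq // enum_uniq.
    have /eqP := wx u; rewrite /w iE iQ mulf_eq0 (negbTE (f_neq0 u)) => /eqP //.
  move=> x z zS; split=> [//|u v euv|i].
    rewrite mulN1r oppr_lt0 => fuv.
    have E : idx u = idx v.
      rewrite /idx; congr index; apply/eqP.
      rewrite component_eq; last exact: same_sign_edge_sym.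
      by apply: connect1; rewrite /same_sign_edge /= euv.
    by rewrite /w E !mulrA; field; rewrite !f_neq0.
  rewrite /w /idx memNindex ?ltnn ?mulr0 // mem_enum inE negb_and negbK.
  by apply/orP; left; apply/imsetP; exists i.
- move=> g [gS gf gr]; split=> [|u v euv h|i]; last by rewrite gr oppr0.
    by apply/(p_sphereP p_gt1); under eq_bigr do rewrite normrN; apply/(p_sphereP p_gt1).
  by rewrite !mulNr (gf u v).
- exact: flat_sphere_closed.
Qed.

Lemma variational_eigenvalue_lt k : (k <= s)%N -> genus_family (V := V) p k !=set0 ->
  (variational_eigenvalue e p rho omega kappa k < lambda%:E)%E.
Proof.
move=> ks k0; have c0 : -1 != 0 :> R by rewrite oppr_eq0 oner_neq0.
have [d d0 gap] := flat_sphere_gap c0.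
apply: (@le_lt_trans _ _ (lambda - d)%:E); last by rewrite lte_fin ltrBlDr ltrDl.
apply: ge_ereal_inf; eexists; first by exists (flat_sphere (-1)); [exact: flat_sphere_genus|].
apply: ge_ereal_sup => _ [g /gap h <-]; rewrite lee_fin.
by move: h; rewrite mulN1r; lra.
Qed.

End Spectral.

Theorem theorem3p8 (R : realType) (V : finType) (e : rel V)
    (p : R) (rho : V -> R) (omega : V -> V -> R) (kappa : V -> R)
    (m : nat) (T : 'I_m -> {set V}) (k : nat) (lambda : R) (f : V -> R)
    (e_sym : symmetric e) (e_irr : irreflexive e)
    (p_gt1 : 1 < p)
    (rho_gt0 : forall u, 0 < rho u)
    (omega_gt0 : forall u v, e u v -> 0 < omega u v)
    (omega_sym : forall u v, e u v -> omega u v = omega v u)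
    (forest : is_disjoint_union_of_trees e T)
    (k_ge1 : (1 <= k)%N) (k_le : (k + m - 1 <= #|V|)%N)
    (lambda_k : forall j, (k <= j <= k + m - 1)%N ->
       variational_eigenvalue e p rho omega kappa j = lambda%:E)
    (f_eigen : is_eigenfunction e p rho omega kappa f lambda)
    (f_neq0 : forall u, f u != 0) :
  #|sign_change_edges e f| = (k - 1)%N /\
  #|nodal_domains e f| = (k - 1 + m)%N.
Proof.
have m_gt0 : (0 < m)%N.
  have [[u _] _] := f_eigen; have [/(_ u)[i _] _ _ _] := forest.
  exact: leq_ltn_trans (ltn_ord i).
have /choice[root rootP] : forall i, exists r, r \in T i := tree_root forest.
(* otherwise lambda_k would be the infimum of the empty set *)
have k_fin : genus_family (V := V) p k !=set0.
  apply/set0P/negP => /eqP E; have := lambda_k k.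
  by rewrite leqnn /variational_eigenvalue E image_set0 ereal_inf0 => h; have := h ltac:(lia).
rewrite (card_nodal_domains e_sym e_irr f_neq0 forest).
suff -> : #|sign_change_edges e f| = (k - 1)%N by [].
apply/eqP; rewrite eqn_leq; apply/andP; split; rewrite leqNgt; apply/negP => h.
  have : (variational_eigenvalue e p rho omega kappa k < lambda%:E)%E.
    apply: (variational_eigenvalue_lt e_sym e_irr p_gt1 rho_gt0 omega_gt0 omega_sym
      forest f_eigen f_neq0 rootP) k_fin; lia.
  by rewrite lambda_k ?ltxx //; lia.
have : (lambda%:E < variational_eigenvalue e p rho omega kappa (k + m - 1))%E.
  apply: (variational_eigenvalue_gt e_sym p_gt1 rho_gt0 omega_gt0 omega_sym
    forest f_eigen f_neq0 rootP); lia.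
by rewrite lambda_k ?ltxx //; lia.
Qed.
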